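(* Suppose that $(x^\star,m^\star)$ is an optimal solution of the reward design problem and that $x^\star$ is an interior point of $\mathcal P_{m^\star}$. For $\tau>0$ let $$m_\tau^\star=\arg\max_{m\in\mathcal M}\Big\{\langle r_2^{x^\star},m\rangle-\tau\sum_{(s,a)\in\mathcal S\times\mathcal A}m(s,a)\log\frac{m(s,a)}{\sum_{a'\in\mathcal A}m(s,a')}\Big\},$$ and let $\mathcal M_{\mathrm{det}}^\star=\mathcal M_{\mathrm{det}}\cap\mathsf{BR}(x^\star)$. Then for any $\tau>0$, $$\langle r_1,m_\tau^\star\rangle\ \ge\ \Big(1-\frac{2\tau}{b(1-\gamma)}\log|\mathcal A|\Big)\langle r_1,m^\star\rangle,$$ where $b=\langle r_2^{x^\star},m^\star\rangle-\max_{m\in\mathcal M_{\mathrm{det}}\setminus\mathcal M_{\mathrm{det}}^\star}\langle r_2^{x^\star},m\rangle$.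
   Context: Setting. $\mathcal S$ and $\mathcal A$ are finite nonempty sets (states, actions); $\mathcal T:\mathcal S\times\mathcal A\times\mathcal S\to[0,1]$ is a transition kernel ($\mathcal T(s,a,s')$ is the probability of moving from $s$ to $s'$ under action $a$); $r:\mathcal S\times\mathcal A\to\mathbb R$; $\gamma\in(0,1)$ is the discount factor; $\rho$ is a probability distribution on $\mathcal S$ (initial distribution). A policy is $\pi:\mathcal S\times\mathcal A\to[0,1]$ with $\sum_a\pi(s,a)=1$ for all $s$; it is deterministic if for every $s$ some $a$ has $\pi(s,a)=1$. The occupancy measure induced by $\pi$ is $m^\pi(s,a)=\sum_{t\ge0}\gamma^t\,\mathbb P_\pi(s_t=s,a_t=a)$ with $s_0\sim\rho$. The set of occupancy measures is $\mathcal M=\{m\in\mathbb R^{\mathcal S\times\mathcal A}: m\ge0,\ \sum_a m(s,a)=\rho(s)+\gamma\sum_{s',a'}\mathcal T(s',a',s)m(s',a')\ \forall s\in\mathcal S\}$ (these are exactly the $m^\pi$), and $\mathcal M_{\mathrm{det}}$ is the set of those induced by deterministic policies. For $f\in\mathbb R^{\mathcal S\times\mathcal A}$, $\langle f,m\rangle=\sum_{s,a}f(s,a)m(s,a)$. $\mathcal S_d\subseteq\mathcal S$ is a nonempty set of states at which reward can be allocated; a reward allocation is $x\in\mathbb R^{\mathcal S_d}$; with budget $C\ge0$ the admissible allocations are $\mathcal X=\{x: x\ge0,\ \sum_{s\in\mathcal S_d}x(s)\le C\}$. The follower's modified reward is $r_2^x(s,a)=r(s,a)+x(s)$ if $s\in\mathcal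 S_d$ and $r_2^x(s,a)=r(s,a)$ otherwise. The leader's reward is $r_1(s,a)=1$ if $s\in\mathcal S_d$ and $0$ otherwise. Best responses: $\mathsf{BR}(x)=\arg\max_{m\in\mathcal M}\langle r_2^x,m\rangle$. The reward design problem is: maximize $\langle r_1,m\rangle$ over $x\in\mathcal X$, $m\in\mathcal M$ subject to $m\in\mathsf{BR}(x)$. The allocation region of $m\in\mathcal M$ is $\mathcal P_m=\{x\in\mathbb R^{\mathcal S_d}: m\in\mathsf{BR}(x)\}$. Conventions: terms $m(s,a)\log(\cdot)$ with $m(s,a)=0$ are $0$; the maximum over the empty set is $-\infty$ (so then $b=+\infty$ and $1/b=0$). *)

(* Defs.v *)
From HB Require Import structures.
From mathcomp Require Import all_boot all_order all_algebra.
From mathcomp Require Import all_classical all_reals all_analysis.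
Set Implicit Arguments.
Unset Strict Implicit.
Unset Printing Implicit Defensive.
Import Order.TTheory GRing.Theory Num.Theory.
Import numFieldNormedType.Exports.
Local Open Scope classical_set_scope.
Local Open Scope ring_scope.

Definition argmax (R : realType) (T : Type) (D : set T) (f : T -> R) : set T :=
  [set x | D x /\ forall y, D y -> f y <= f x].

Definition is_distr (R : realType) (T : finType) (p : T -> R) : Prop :=
  (forall x, 0 <= p x) /\ \sum_x p x = 1.

Record mdp (R : realType) (S A : finType) := MDP {
  trans : S -> A -> S -> R;
  reward : S -> A -> R;
  discount : R;
  init : S -> R;
  trans_distr : forall s a, is_distr (trans s a);
  discount_gt0 : 0 < discount;
  discount_lt1 : discount < 1;
  init_distr : is_distr init }.

Definition is_policy (R : realType) (S A : finType) (pi : S -> A -> R) : Prop :=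
  forall s, is_distr (pi s).

Definition deterministic (R : realType) (S A : finType) (pi : S -> A -> R) :
    Prop :=
  forall s, exists a, pi s a = 1.

(* Law of the trajectory (s_0, a_0), ..., (s_t, a_t), where [h i = (s_i, a_i)]. *)
Definition traj_prob (R : realType) (S A : finType) (M : mdp R S A)
    (pi : S -> A -> R) (t : nat) (h : {ffun 'I_t.+1 -> S * A}) : R :=
  init M (h ord0).1
  * (\prod_(i < t.+1) pi (h i).1 (h i).2)
  * (\prod_(i < t) trans M (h (widen_ord (leqnSn t) i)).1
                           (h (widen_ord (leqnSn t) i)).2
                           (h (lift ord0 i)).1).

(* The probability, under [pi], that s_t = s and a_t = a. *)
Definition step_prob (R : realType) (S A : finType) (M : mdp R S A)
    (pi : S -> A -> R) (t : nat) (s : S) (a : A) : R :=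
  \sum_(h : {ffun 'I_t.+1 -> S * A} | h ord_max == (s, a)) traj_prob M pi h.

Definition occupancy (R : realType) (S A : finType) (M : mdp R S A)
    (pi : S -> A -> R) : S -> A -> R :=
  fun s a => limn (series (fun t => discount M ^+ t * step_prob M pi t s a)).

Definition occ_set (R : realType) (S A : finType) (M : mdp R S A) :
    set (S -> A -> R) :=
  [set m | (forall s a, 0 <= m s a) /\
     forall s, \sum_a m s a =
       init M s + discount M * \sum_s' \sum_a' trans M s' a' s * m s' a'].

Definition occ_det (R : realType) (S A : finType) (M : mdp R S A) :
    set (S -> A -> R) :=
  [set m | exists pi, [/\ is_policy pi, deterministic pi & m = occupancy M pi]].

Definition pairing (R : realType) (S A : finType) (f m : S -> A -> R) : R :=
  \sum_s \sum_a f s a * m s a.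

(* [{ptws _ -> R}] is the function space with the product topology; the index
   type is finite, so this is the Euclidean topology on R^{Sd}. *)
Definition allocation (R : realType) (S : finType) (Sd : {set S}) :=
  {ptws {s : S | s \in Sd} -> R}.

Definition admissible (R : realType) (S : finType) (Sd : {set S}) (C : R) :
    set (allocation R Sd) :=
  [set x | (forall s, 0 <= x s) /\ \sum_s x s <= C].

Definition follower_reward (R : realType) (S A : finType) (M : mdp R S A)
    (Sd : {set S}) (x : allocation R Sd) : S -> A -> R :=
  fun s a => if insub s is Some u then reward M s a + x u else reward M s a.

Definition leader_reward (R : realType) (S A : finType) (Sd : {set S}) :
    S -> A -> R :=
  fun s _ => if s \in Sd then 1 else 0.

Definition best_response (R : realType) (S A : finType) (M : mdp R S A)
    (Sd : {set S}) (x : allocation R Sd) : set (S -> A -> R) :=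
  argmax (occ_set M) (pairing (follower_reward M x)).

Definition reward_design_optimal (R : realType) (S A : finType)
    (M : mdp R S A) (Sd : {set S}) (C : R) (x : allocation R Sd)
    (m : S -> A -> R) : Prop :=
  argmax
    [set z : allocation R Sd * (S -> A -> R) |
      [/\ admissible C z.1, occ_set M z.2 & best_response M z.1 z.2]]
    (fun z => pairing (leader_reward R Sd) z.2) (x, m).

Definition alloc_region (R : realType) (S A : finType) (M : mdp R S A)
    (Sd : {set S}) (m : S -> A -> R) : set (allocation R Sd) :=
  [set x | best_response M x m].

(* Terms with [m s a = 0] vanish, whatever the value of [ln] and of the
   quotient there. *)
Definition regularized_value (R : realType) (S A : finType) (M : mdp R S A)
    (Sd : {set S}) (x : allocation R Sd) (tau : R) (m : S -> A -> R) : R :=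
  pairing (follower_reward M x) m
  - tau * \sum_s \sum_a m s a * ln (m s a / \sum_a' m s a').

Definition occ_det_opt (R : realType) (S A : finType) (M : mdp R S A)
    (Sd : {set S}) (x : allocation R Sd) : set (S -> A -> R) :=
  occ_det M `&` best_response M x.

(* The supremum is over a finite set of reals, hence a maximum when that set is
   nonempty; on the empty set it is -oo and the gap is +oo. *)
Definition value_gap (R : realType) (S A : finType) (M : mdp R S A)
    (Sd : {set S}) (x : allocation R Sd) (mstar : S -> A -> R) : \bar R :=
  ((pairing (follower_reward M x) mstar)%:E
   - ereal_sup [set (pairing (follower_reward M x) m)%:E
               | m in occ_det M `\` occ_det_opt M x])%E.

(* Main.v *)
(* Interiority of [xstar] forces all best responses to visit each state of [Sd]
   with the same total mass, so they all give the leader the value [v] of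
   [mstar]. Entropies of occupancy measures lie between [0] and
   [ln #|A| / (1 - gamma)], so [mtau] loses at most [tau ln #|A| / (1 - gamma)]
   of the follower's optimal value. A convex decomposition of [mtau] into
   deterministic occupancy measures would then put weight at most
   [tau ln #|A| / (b (1 - gamma))] on the suboptimal ones. The decomposition is
   replaced by its dual form: every linear functional attains its minimum over
   the occupancy measures at a deterministic policy, which follows from policy
   improvement. This gives the bound without the factor [2]. *)
Require Import Defs.
From HB Require Import structures.
From mathcomp Require Import all_boot all_order all_algebra.
From mathcomp Require Import all_classical all_reals all_analysis.
From mathcomp Require Import ring lra.
Import Order.TTheory GRing.Theory Num.Theory.
Import numFieldNormedType.Exports.
Local Open Scope classical_set_scope.
Local Open Scope ring_scope.

(** * Trajectory laws and the flow equation of occupancy measures *)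

Definition ffun_rcons {X : Type} {n : nat} (k : {ffun 'I_n -> X}) (x : X) :
    {ffun 'I_n.+1 -> X} :=
  [ffun i => if unlift ord_max i is Some j then k j else x].

Lemma ffun_rcons_max {X : Type} {n : nat} (k : {ffun 'I_n -> X}) (x : X) :
  ffun_rcons k x ord_max = x.
Proof. by rewrite ffunE unlift_none. Qed.

Lemma ffun_rcons_init {X : Type} {n : nat} (k : {ffun 'I_n -> X}) (x : X)
    (i : 'I_n.+1) (j : 'I_n) :
  i = j :> nat -> ffun_rcons k x i = k j.
Proof.
move=> ij; have -> : i = lift ord_max j.
  by apply: val_inj; rewrite /= ij /bump leqNgt ltn_ord.
by rewrite ffunE liftK.
Qed.

Lemma sum_ffun_recr {V : nmodType} {X : finType} {n : nat}
    (F : {ffun 'I_n.+1 -> X} -> V) :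
  \sum_h F h = \sum_(k : {ffun 'I_n -> X}) \sum_x F (ffun_rcons k x).
Proof.
rewrite pair_big /=.
rewrite (reindex (fun p : {ffun 'I_n -> X} * X => ffun_rcons p.1 p.2)) //=.
exists (fun h => ([ffun i => h (lift ord_max i)], h ord_max)).
  move=> [k x] _ /=; rewrite ffun_rcons_max; congr pair.
  by apply/ffunP => i; rewrite !ffunE liftK.
move=> h _; apply/ffunP => i; rewrite ffunE /=.
by case: unliftP => [j|] ->; rewrite ?ffunE.
Qed.

Lemma step_prob0 {R : realType} {S A : finType} (M : mdp R S A)
    (pi : S -> A -> R) (s : S) (a : A) :
  step_prob M pi 0 s a = init M s * pi s a.
Proof.
rewrite /step_prob (big_pred1 [ffun=> (s, a)]) => [|h].
  by rewrite /traj_prob big_ord1 big_ord0 mulr1 !ffunE.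
apply/eqP/eqP => [hsa|->]; last by rewrite ffunE.
by apply/ffunP => i; rewrite ffunE -hsa (ord1 i); congr (h _); apply: val_inj.
Qed.

Lemma traj_prob_rcons {R : realType} {S A : finType} (M : mdp R S A)
    (pi : S -> A -> R) (t : nat) (k : {ffun 'I_t.+1 -> S * A}) (x : S * A) :
  traj_prob M pi (ffun_rcons k x) =
  traj_prob M pi k * trans M (k ord_max).1 (k ord_max).2 x.1 * pi x.1 x.2.
Proof.
rewrite /traj_prob big_ord_recr [X in _ * _ * X = _]big_ord_recr /=.
rewrite (ffun_rcons_init _ _ ord0 ord0) // ffun_rcons_max.
rewrite (ffun_rcons_init _ _ (widen_ord _ ord_max) ord_max) //.
have -> : lift ord0 (ord_max : 'I_t.+1) = ord_max by apply: val_inj.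
rewrite ffun_rcons_max.
have -> : \prod_(i < t.+1) pi
    (ffun_rcons k x (widen_ord (leqnSn t.+1) i)).1
    (ffun_rcons k x (widen_ord (leqnSn t.+1) i)).2 =
  \prod_(i < t.+1) pi (k i).1 (k i).2.
  by apply: eq_bigr => i _; rewrite (ffun_rcons_init _ _ _ i).
set p := \prod_(i < t) _; set q := \prod_(i < t) _.
have -> : p = q.
  apply: eq_bigr => i _.
  rewrite (ffun_rcons_init _ _ _ (widen_ord (leqnSn t) i)) //.
  by rewrite (ffun_rcons_init _ _ _ (lift ord0 i)).
ring.
Qed.

(** Markov property: a trajectory ending in [(s, a)] at time [t.+1] is a one-step extension, so the
    sum is grouped by the pair visited at time [t]. *)
Lemma step_probS {R : realType} {S A : finType} (M : mdp R S A)
    (pi : S -> A -> R) (t : nat) (s : S) (a : A) :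
  step_prob M pi t.+1 s a =
  (\sum_s' \sum_a' trans M s' a' s * step_prob M pi t s' a') * pi s a.
Proof.
rewrite /step_prob big_mkcond /= sum_ffun_recr.
rewrite (eq_bigr (fun k => traj_prob M pi (ffun_rcons k (s, a)))); last first.
  move=> k _; under eq_bigr do rewrite ffun_rcons_max.
  by rewrite -big_mkcond /= big_pred1_eq.
rewrite pair_big big_distrl /=.
rewrite (partition_big (fun k : {ffun 'I_t.+1 -> S * A} => k ord_max)
           xpredT) //=.
apply: eq_bigr => -[s' a'] _ /=; rewrite mulr_sumr mulr_suml.
apply: eq_bigr => k /eqP ks; rewrite traj_prob_rcons ks /=; ring.
Qed.

Lemma step_prob_ge0 {R : realType} {S A : finType} (M : mdp R S A)
    (pi : S -> A -> R) (t : nat) (s : S) (a : A) :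
  is_policy pi -> 0 <= step_prob M pi t s a.
Proof.
move=> pol; elim: t s a => [|t IH] s a.
  by rewrite step_prob0 mulr_ge0 ?(pol s).1 // (init_distr M).1.
rewrite step_probS mulr_ge0 ?(pol s).1 // sumr_ge0 // => s' _.
by rewrite sumr_ge0 // => a' _; rewrite mulr_ge0 // (trans_distr M s' a').1.
Qed.

Lemma sum_step_prob {R : realType} {S A : finType} (M : mdp R S A)
    (pi : S -> A -> R) (t : nat) :
  is_policy pi -> \sum_s \sum_a step_prob M pi t s a = 1.
Proof.
move=> pol; elim: t => [|t IH].
  rewrite -(init_distr M).2; apply: eq_bigr => s _.
  by under eq_bigr do rewrite step_prob0; rewrite -mulr_sumr (pol s).2 mulr1.
under eq_bigr => s _.
  under eq_bigr do rewrite step_probS.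
  rewrite -mulr_sumr (pol s).2 mulr1.
  over.
rewrite exchange_big -IH /=; apply: eq_bigr => s' _.
rewrite exchange_big /=; apply: eq_bigr => a' _.
by rewrite -mulr_suml (trans_distr M s' a').2 mul1r.
Qed.

Lemma step_prob_le1 {R : realType} {S A : finType} (M : mdp R S A)
    (pi : S -> A -> R) (t : nat) (s : S) (a : A) :
  is_policy pi -> step_prob M pi t s a <= 1.
Proof.
move=> pol; rewrite -(sum_step_prob M pi t pol).
rewrite (bigD1 s) //= (bigD1 a) //= -addrA lerDl addr_ge0 //.
  by apply: sumr_ge0 => *; apply: step_prob_ge0.
by apply: sumr_ge0 => *; apply: sumr_ge0 => *; apply: step_prob_ge0.
Qed.

(** Domination by the geometric series; this makes the [limn] in [occupancy] a genuine limit. *)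
Lemma occupancy_cvg {R : realType} {S A : finType} (M : mdp R S A)
    (pi : S -> A -> R) (s : S) (a : A) :
  is_policy pi ->
  series (fun t => discount M ^+ t * step_prob M pi t s a) @ \oo
    --> occupancy M pi s a.
Proof.
move=> pol; have g0 := ltW (discount_gt0 M).
apply: (@series_le_cvg _ _ (geometric 1 (discount M))).
- by move=> n; rewrite mulr_ge0 ?exprn_ge0 ?step_prob_ge0.
- by move=> n; rewrite /= mul1r exprn_ge0.
- by move=> n; rewrite /= mul1r ler_piMr ?exprn_ge0 ?step_prob_le1.
- by apply: is_cvg_geometric_series; rewrite ger0_norm // discount_lt1.
Qed.

Lemma series_step_probS {R : realType} {S A : finType} (M : mdp R S A)
    (pi : S -> A -> R) (s : S) (a : A) (n : nat) :
  series (fun t => discount M ^+ t * step_prob M pi t s a) n.+1 =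
  (init M s + discount M * \sum_s' \sum_a' trans M s' a' s *
     series (fun t => discount M ^+ t * step_prob M pi t s' a') n) * pi s a.
Proof.
rewrite /series /= big_nat_recl // expr0 mul1r step_prob0 mulrDl; congr +%R.
set u := fun s' a' t => discount M ^+ t * step_prob M pi t s' a'.
have -> : \sum_s' \sum_a' trans M s' a' s * (\sum_(0 <= t < n) u s' a' t) =
    \sum_(0 <= t < n) \sum_s' \sum_a' trans M s' a' s * u s' a' t.
  rewrite [RHS]exchange_big /=; apply: eq_bigr => s' _.
  by rewrite [RHS]exchange_big /=; apply: eq_bigr => a' _; rewrite mulr_sumr.
rewrite mulr_sumr mulr_suml; apply: eq_bigr => t _.
rewrite step_probS exprS !mulrA; congr (_ * _).
rewrite -!mulrA; congr (_ * _); rewrite mulr_sumr; apply: eq_bigr => s' _.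
by rewrite mulr_sumr; apply: eq_bigr => a' _; rewrite mulrCA.
Qed.

(** Limit of the recursion on partial sums. The form with the factor [pi s a] says more than the
    flow constraint: it also shows that [occupancy] vanishes on actions that [pi] does not take. *)
Lemma occupancy_flow {R : realType} {S A : finType} (M : mdp R S A)
    (pi : S -> A -> R) (s : S) (a : A) :
  is_policy pi ->
  occupancy M pi s a = (init M s +
    discount M * \sum_s' \sum_a' trans M s' a' s * occupancy M pi s' a') * pi s a.
Proof.
move=> pol; pose u s a := series (fun t => discount M ^+ t * step_prob M pi t s a).
have uS : (fun n => u s a n.+1) @ \oo --> occupancy M pi s a.
  by rewrite (cvg_shiftS (u s a)); exact: occupancy_cvg.
apply: (cvg_unique _ uS) => //.
rewrite (_ : (fun n => u s a n.+1) = fun n => (init M s +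
    discount M * \sum_s' \sum_a' trans M s' a' s * u s' a' n) * pi s a); last first.
  by apply/funext => n; rewrite /u series_step_probS.
apply: cvgM; last exact: cvg_cst.
apply: cvgD; first exact: cvg_cst.
apply: cvgM; first exact: cvg_cst.
apply: (cvg_big add_continuous) => s' _; apply: (cvg_big add_continuous) => a' _.
by apply: cvgM; [exact: cvg_cst|exact: occupancy_cvg].
Qed.

Lemma occupancy_in_occ_set {R : realType} {S A : finType} (M : mdp R S A)
    (pi : S -> A -> R) :
  is_policy pi -> occ_set M (occupancy M pi).
Proof.
move=> pol; split=> [s a|s]; last first.
  by under eq_bigr do rewrite occupancy_flow //; rewrite -mulr_sumr (pol s).2 mulr1.
apply: limr_ge; first by apply/cvg_ex; eexists; exact: occupancy_cvg.
apply: nearW => n; rewrite /series /=.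
apply: sumr_ge0 => t _; rewrite mulr_ge0 ?exprn_ge0 ?step_prob_ge0 //.
exact: ltW (discount_gt0 M).
Qed.

(** * Discounted value functions *)

(* At a minimizer [s] of [W], the hypothesis gives [W s >= c * W s]. *)
Lemma min_principle {R : realType} {S : finType} (P : S -> S -> R) (c : R)
    (W : S -> R) :
  (forall s, is_distr (P s)) -> 0 <= c < 1 ->
  (forall s, c * \sum_s' P s s' * W s' <= W s) -> forall s, 0 <= W s.
Proof.
move=> Pd /andP[c0 c1] hW s0.
have := @arg_minP _ _ _ s0 xpredT W isT; case=> s _ smin.
apply: le_trans (smin s0 isT).
have : W s <= \sum_s' P s s' * W s'.
  rewrite -{1}[W s]mul1r -(Pd s).2 mulr_suml ler_sum // => s' _.
  by rewrite ler_wpM2l ?(Pd s).1 ?smin.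
move=> /(ler_wpM2l c0) /le_trans /(_ (hW s)).
by rewrite -subr_ge0 -{1}[W s]mul1r -mulrBl pmulr_rge0 // subr_gt0.
Qed.

(** The operator [v - c P v] is injective, by [min_principle] applied to a kernel vector and its
    opposite, hence surjective in finite dimension. *)
Lemma policy_value_exists {R : realType} {S : finType} (P : S -> S -> R) (c : R)
    (g : S -> R) :
  (forall s, is_distr (P s)) -> 0 <= c < 1 ->
  exists V : S -> R, forall s, V s = g s + c * \sum_s' P s s' * V s'.
Proof.
move=> Pd c01.
pose L (v : {ffun S -> R^o}) : {ffun S -> R^o} :=
  [ffun s => v s - c * \sum_s' P s s' * v s'].
have Llin : linear L.
  move=> k u v; apply/ffunP => s; rewrite !ffunE /=.
  under eq_bigr do rewrite !ffunE mulrDr.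
  rewrite big_split /= mulrDr /GRing.scale /=.
  have -> : \sum_i P s i * (k * u i) = k * \sum_i P s i * u i.
    by rewrite mulr_sumr; apply: eq_bigr => i _; ring.
  ring.
pose Lm := HB.pack_for {linear {ffun S -> R^o} -> {ffun S -> R^o}} L
  (GRing.isLinear.Build _ _ _ _ L Llin).
have LE v : linfun Lm v = L v by rewrite lfunE.
have ker0 : lker (linfun Lm) == 0%VS.
  apply/lker0P => u v; rewrite !LE => Luv.
  have diff0 (w : {ffun S -> R^o}) : L w = 0 -> forall s, 0 <= w s.
    move=> /ffunP Lw; apply: (min_principle P c) => // s.
    by have := Lw s; rewrite !ffunE => /eqP; rewrite subr_eq0 => /eqP <-.
  have LB (x y : {ffun S -> R^o}) : L x = L y -> L (x - y) = 0.
    by move=> xy; rewrite -[L]/(Lm : _ -> _) raddfB /= xy subrr.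
  apply/ffunP => s; apply/eqP; rewrite eq_le.
  have := diff0 _ (LB _ _ Luv) s; have := diff0 _ (LB _ _ (esym Luv)) s.
  by rewrite !ffunE !subr_ge0 => -> ->.
pose gf : {ffun S -> R^o} := [ffun s => g s].
have /memv_imgP[v _ vE] : gf \in limg (linfun Lm).
  by rewrite (lker0_limgf ker0) memvf.
exists v => s; move: vE; rewrite LE => /ffunP/(_ s); rewrite !ffunE => ->.
by rewrite subrK.
Qed.

(** * Deterministic policies and linear minimization over occupancy measures *)

Definition det_policy {R : realType} {S A : finType} (d : S -> A) : S -> A -> R :=
  fun s a => (a == d s)%:R.

Lemma sum_det_policy {R : realType} {S A : finType} (d : S -> A) (s : S)
    (F : A -> R) :
  \sum_a F a * det_policy d s a = F (d s).
Proof.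
rewrite (bigD1 (d s)) //= /det_policy eqxx mulr1 big1 ?addr0 // => a /negbTE ->.
by rewrite mulr0.
Qed.

Lemma det_policy_policy {R : realType} {S A : finType} (d : S -> A) :
  is_policy (det_policy d : S -> A -> R).
Proof.
move=> s; split=> [a|]; first exact: ler0n.
by rewrite -[RHS](sum_det_policy d s (fun=> 1)); under [RHS]eq_bigr do rewrite mul1r.
Qed.

Lemma det_policy_occ_det {R : realType} {S A : finType} (M : mdp R S A)
    (d : S -> A) :
  occ_det M (occupancy M (det_policy d)).
Proof.
exists (det_policy d); split=> //; first exact: det_policy_policy.
by move=> s; exists (d s); rewrite /det_policy eqxx.
Qed.

(** An action of probability 1 leaves no mass for the others. Taking [d] in [{ffun S -> A}] places
    the deterministic policies in a finite type. *)
Lemma deterministic_det_policy {R : realType} {S A : finType} (pi : S -> A -> R) :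
  is_policy pi -> deterministic pi -> exists d : {ffun S -> A}, pi = det_policy d.
Proof.
move=> pol /choice[d dE]; exists (finfun d); apply/funext => s; apply/funext => a.
rewrite /det_policy ffunE; case: eqVneq => [->|ad]; first exact: dE.
apply/eqP; rewrite eq_le (pol s).1 andbT.
have := (pol s).2; rewrite (bigD1 (d s)) //= dE (bigD1 a) //= => h.
have : 0 <= \sum_(i | (i != d s) && (i != a)) pi s i.
  by apply: sumr_ge0 => i _; exact: (pol s).1.
by move=> h'; rewrite -(lerD2r (\sum_(i | (i != d s) && (i != a)) pi s i)); lra.
Qed.

(** The flow constraint tested against [V] and summed by parts; the right-hand side does not depend
    on [m]. *)
Lemma pairing_flow {R : realType} {S A : finType} (M : mdp R S A)
    (V : S -> R) (m : S -> A -> R) :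
  occ_set M m ->
  pairing (fun s a => V s - discount M * \sum_s' trans M s a s' * V s') m =
  \sum_s init M s * V s.
Proof.
move=> [_ flow]; rewrite /pairing.
have -> : \sum_s init M s * V s =
  \sum_s V s * (\sum_a m s a - discount M * \sum_s' \sum_a' trans M s' a' s * m s' a').
  by apply: eq_bigr => s _; rewrite flow addrK mulrC.
under eq_bigr do (under eq_bigr do rewrite mulrBl; rewrite sumrB -mulr_sumr).
rewrite sumrB; under [RHS]eq_bigr do rewrite mulrBr; rewrite sumrB; congr (_ - _).
under [RHS]eq_bigr => s _.
  rewrite mulrCA !mulr_sumr.
  under eq_bigr do rewrite !mulr_sumr.
  over.
rewrite [RHS]exchange_big; apply: eq_bigr => s' _ /=.
rewrite [RHS]exchange_big; apply: eq_bigr => a' _ /=.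
rewrite mulr_sumr mulr_suml; apply: eq_bigr => s _; ring.
Qed.

(* Policy improvement: a deterministic policy minimizing the sum of its values
   satisfies Bellman's optimality inequality. *)
Lemma bellman_optimal_exists {R : realType} {S A : finType} (M : mdp R S A)
    (A_nonempty : (0 < #|A|)%N) (g : S -> A -> R) :
  exists (d : S -> A) (V : S -> R),
    (forall s, V s = g s (d s) + discount M * \sum_s' trans M s (d s) s' * V s') /\
    (forall s a, V s <= g s a + discount M * \sum_s' trans M s a s' * V s').
Proof.
have c01 : 0 <= discount M < 1 by rewrite ltW ?discount_gt0 ?discount_lt1.
have Vex (d : {ffun S -> A}) : exists V : S -> R,
    forall s, V s = g s (d s) + discount M * \sum_s' trans M s (d s) s' * V s'.
  by apply: policy_value_exists c01 => s; exact: trans_distr.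
have [V VE] := choice Vex.
have /card_gt0P[a0 _] := A_nonempty.
have := @arg_minP _ _ _ [ffun=> a0] xpredT (fun d => \sum_s V d s) isT.
case=> d _ dmin; exists d, (V d); split=> // s0 a0'; rewrite leNgt; apply/negP => lt0.
pose d' : {ffun S -> A} := [ffun s => if s == s0 then a0' else d s].
pose W s := V d s - V d' s.
(* [W] solves the value equation of [d'] with a source supported at [s0], where it equals the strict
   improvement assumed for contradiction. *)
have Wge s : discount M * \sum_s' trans M s (d' s) s' * W s' + (s == s0)%:R *
   (V d s0 - (g s0 a0' + discount M * \sum_s' trans M s0 a0' s' * V d s')) = W s.
  rewrite /W (VE d' s); under eq_bigr do rewrite mulrBr; rewrite sumrB ffunE.
  by case: eqVneq => [->|_]; rewrite ?(VE d s) /=; ring.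
have W0 : forall s, 0 <= W s.
  apply: (min_principle (fun s => trans M s (d' s)) (discount M)) => // [s|s].
    exact: trans_distr.
  by rewrite -[X in _ <= X]Wge lerDl mulr_ge0 // subr_ge0 ltW.
have Ws0 : 0 < W s0.
  rewrite -Wge eqxx mul1r ltr_wpDl ?subr_gt0 // mulr_ge0 ?(ltW (discount_gt0 M)) //.
  by apply: sumr_ge0 => s _; rewrite mulr_ge0 // (trans_distr M s0 _).1.
have := dmin d' isT; rewrite leNgt => /negP; apply.
rewrite -subr_gt0 -sumrB (bigD1 s0) //= ltr_pwDl //.
by apply: sumr_ge0 => s _; exact: W0.
Qed.

(** Linear programming duality: Bellman's inequality bounds [g] below by [V s - discount M *
    E[V s']], whose pairing is the same for all of [occ_set]. Equality holds on the actions chosen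
    by [d], the only ones its occupancy measure charges. *)
Lemma pairing_min_det {R : realType} {S A : finType} (M : mdp R S A)
    (A_nonempty : (0 < #|A|)%N) (g m : S -> A -> R) :
  occ_set M m -> exists2 m', occ_det M m' & pairing g m' <= pairing g m.
Proof.
move=> Mm; have [d [V [VE Vle]]] := bellman_optimal_exists M A_nonempty g.
have pol := @det_policy_policy R S A d.
exists (occupancy M (det_policy d)); first exact: det_policy_occ_det.
have -> : pairing g (occupancy M (det_policy d)) = \sum_s init M s * V s.
  rewrite -(pairing_flow M V _ (occupancy_in_occ_set M _ pol)).
  apply: eq_bigr => s _; apply: eq_bigr => a _.
  rewrite occupancy_flow // /det_policy; case: eqVneq => [->|]; last by rewrite !mulr0.
  by rewrite {1}VE addrK.
rewrite -(pairing_flow M V _ Mm); apply: ler_sum => s _; apply: ler_sum => a _.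
by rewrite ler_wpM2r ?Mm.1 // lerBlDr.
Qed.

(** * Interiority and the leader's value at best responses *)

Lemma pairing_leader {R : realType} {S A : finType} (Sd : {set S})
    (m : S -> A -> R) :
  pairing (leader_reward R Sd) m = \sum_(s in Sd) \sum_a m s a.
Proof.
rewrite /pairing [RHS]big_mkcond /=; apply: eq_bigr => s _.
rewrite /leader_reward -mulr_sumr.
by case: (s \in Sd); rewrite ?mul1r ?mul0r.
Qed.

Lemma pairing_follower_dfwith {R : realType} {S A : finType} (M : mdp R S A)
    (Sd : {set S}) (x : allocation R Sd) (u : {s : S | s \in Sd}) (y : R)
    (m : S -> A -> R) :
  pairing (follower_reward M (dfwith x u y : allocation R Sd)) m =
  pairing (follower_reward M x) m + (y - x u) * \sum_a m (val u) a.
Proof.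
rewrite /pairing (bigD1 (val u)) //= [in RHS](bigD1 (val u)) //=.
rewrite addrAC; congr (_ + _).
  rewrite mulr_sumr -big_split /=; apply: eq_bigr => a _.
  by rewrite /follower_reward valK dfwithin; ring.
apply: eq_bigr => s su; apply: eq_bigr => a _; congr (_ * _).
rewrite /follower_reward; case: insubP => // v _ vs.
by rewrite dfwithout //; apply: contraNneq su => ->; rewrite vs.
Qed.

(* On a neighborhood of [x], the linear map [y |-> <r_2^y, m - m'>] is
   nonnegative and vanishes at [x], hence it is zero. *)
Lemma interior_state_mass {R : realType} {S A : finType} (M : mdp R S A)
    (Sd : {set S}) (x : allocation R Sd) (m m' : S -> A -> R)
    (u : {s : S | s \in Sd}) :
  interior (alloc_region M (Sd:=Sd) m) x -> best_response M x m' ->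
  \sum_a m' (val u) a = \sum_a m (val u) a.
Proof.
move=> xint [Mm' m'max].
have [Mm mmax] : best_response M x m by exact: nbhs_singleton xint.
have mm' : pairing (follower_reward M x) m = pairing (follower_reward M x) m'.
  by apply/eqP; rewrite eq_le mmax ?m'max.
(* Only the coordinate [u] is moved, which isolates the mass at the single state [val u]. *)
have /nbhs_ballP[e /= e0 he] :
    nbhs (x u) (dfwith x u @^-1` alloc_region M (Sd:=Sd) m).
  have xE : dfwith x u (x u) = x by apply/funext => v; case: dfwithP.
  apply: (@dfwith_continuous _ (fun=> R : topologicalType) x u (x u)).
  by rewrite xE.
have small (t : R) : `|t| < e -> t * \sum_a m' (val u) a <= t * \sum_a m (val u) a.
  move=> te; have /he : ball (x u) e (x u + t).
    by rewrite /ball /= opprD addNKr normrN.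
  move=> [_ /(_ _ Mm')]; rewrite !pairing_follower_dfwith mm' lerD2l.
  by rewrite addrAC subrr add0r.
(* The steps [e / 2] and [- (e / 2)] give the two opposite inequalities. *)
have e2 : 0 < e / 2 by rewrite divr_gt0.
have e2e : `|e / 2| < e by rewrite gtr0_norm // ltr_pdivrMr // ltr_pMr // ltr1n.
apply/eqP; rewrite eq_le; apply/andP; split.
  by rewrite -(ler_pM2l e2); exact: small.
by rewrite -(ler_nM2l (_ : - (e / 2) < 0)) ?oppr_lt0 //; apply: small; rewrite normrN.
Qed.

Lemma interior_leader_value {R : realType} {S A : finType} (M : mdp R S A)
    (Sd : {set S}) (x : allocation R Sd) (m m' : S -> A -> R) :
  interior (alloc_region M (Sd:=Sd) m) x -> best_response M x m' ->
  pairing (leader_reward R Sd) m' = pairing (leader_reward R Sd) m.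
Proof.
move=> xint m'BR; rewrite !pairing_leader; apply: eq_bigr => s sSd.
exact: (interior_state_mass M Sd x m m' (Sub s sSd) xint m'BR).
Qed.

(** * Total mass and entropy bounds *)

Lemma occ_set_mass {R : realType} {S A : finType} (M : mdp R S A)
    (m : S -> A -> R) :
  occ_set M m -> \sum_s \sum_a m s a = (1 - discount M)^-1.
Proof.
move=> Mm; have c0 : 1 - discount M != 0 by rewrite gt_eqF // subr_gt0 discount_lt1.
apply: (mulIf c0); rewrite mulVf //.
(* For [V = 1] the tested function is the constant [1 - discount M]. *)
have := pairing_flow M (fun=> 1) m Mm; rewrite /pairing.
under [RHS]eq_bigr do rewrite mulr1; rewrite (init_distr M).2 => flow; rewrite -[RHS]flow.
rewrite mulr_suml; apply: eq_bigr => s _; rewrite mulr_suml; apply: eq_bigr => a _.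
have -> : \sum_s' trans M s a s' * 1 = 1.
  by under eq_bigr do rewrite mulr1; exact: (trans_distr M s a).2.
by rewrite mulr1 mulrC.
Qed.

(** Conditional entropy of the action given the state, weighted by the mass of each state. *)
Definition entropy {R : realType} {S A : finType} (m : S -> A -> R) : R :=
  - \sum_s \sum_a m s a * ln (m s a / \sum_a' m s a').

Lemma ln_le_sub1 {R : realType} (x : R) : 0 < x -> ln x <= x - 1.
Proof.
by move=> x0; have := @le_ln1Dx R (x - 1); rewrite addrCA subrr addr0; apply; lra.
Qed.

Lemma entropy_ge0 {R : realType} {S A : finType} (m : S -> A -> R) :
  (forall s a, 0 <= m s a) -> 0 <= entropy m.
Proof.
move=> m0; rewrite oppr_ge0; apply: sumr_le0 => s _; apply: sumr_le0 => a _.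
have [->|ma0] := eqVneq (m s a) 0; first by rewrite mul0r.
have {ma0} ma0 : 0 < m s a by rewrite lt_neqAle eq_sym ma0 m0.
have le_mass : m s a <= \sum_a' m s a'.
  by rewrite (bigD1 a) //= lerDl sumr_ge0.
apply: mulr_ge0_le0 => //; apply: ln_le0.
by rewrite ler_pdivrMr ?mul1r // (lt_le_trans ma0).
Qed.

(* Gibbs' inequality against the uniform policy. *)
Lemma entropy_le {R : realType} {S A : finType} (m : S -> A -> R) :
  (0 < #|A|)%N -> (forall s a, 0 <= m s a) ->
  entropy m <= ln (#|A|%:R : R) * \sum_s \sum_a m s a.
Proof.
move=> A0 m0; have n0 : 0 < #|A|%:R :> R by rewrite ltr0n.
rewrite /entropy -sumrN mulr_sumr; apply: ler_sum => s _.
set w := \sum_a m s a.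
rewrite -subr_ge0 opprK {1}/w mulr_sumr -big_split /=.
(* The first-order terms of [ln x <= x - 1] sum to zero over the actions, so the bound may be proved
   term by term. *)
have sum0 : \sum_a (m s a - w / #|A|%:R) = 0.
  have wE : \sum_(a : A) w / #|A|%:R = w.
    by rewrite sumr_const -[LHS]mulr_natr divfK ?gt_eqF.
  by rewrite sumrB wE subrr.
rewrite -[X in X <= _]sum0; apply: ler_sum => a _.
have [->|ma0] := eqVneq (m s a) 0.
  rewrite mul0r mulr0 addr0 sub0r oppr_le0 divr_ge0 ?ler0n //.
  exact: sumr_ge0.
have {ma0} ma0 : 0 < m s a by rewrite lt_neqAle eq_sym ma0 m0.
have w0 : 0 < w by rewrite (lt_le_trans ma0) // /w (bigD1 a) //= lerDl sumr_ge0.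
(* The argument is the ratio of the uniform probability to the conditional one [m s a / w]. *)
have := @ln_le_sub1 R (w / (m s a * #|A|%:R)) _.
rewrite divr_gt0 ?mulr_gt0 // => /(_ isT).
rewrite !ln_div ?posrE ?mulr_gt0 // lnM ?posrE // => /(ler_wpM2l (m0 s a)).
have -> : m s a * (w / (m s a * #|A|%:R) - 1) = w / #|A|%:R - m s a.
  by field; rewrite !gt_eqF.
lra.
Qed.

(** * Value gaps and the final estimate *)

Lemma regularized_argmax_gap {R : realType} {S A : finType} (M : mdp R S A)
    (Sd : {set S}) (x : allocation R Sd) (tau : R) (m mtau : S -> A -> R) :
  (0 < #|A|)%N -> 0 < tau -> occ_set M m ->
  argmax (occ_set M) (regularized_value M x tau) mtau ->
  pairing (follower_reward M x) m - pairing (follower_reward M x) mtau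
    <= tau * ln (#|A|%:R : R) / (1 - discount M).
Proof.
move=> A0 tau0 Mm [Mmtau /(_ m Mm)].
(* Optimality of [mtau] is tested against [m], with the upper entropy bound for [mtau] and the lower
   one for [m]. *)
have := entropy_le mtau A0 Mmtau.1; rewrite (occ_set_mass M _ Mmtau).
have := entropy_ge0 m Mm.1; rewrite /regularized_value /entropy.
move=> /(mulr_ge0 (ltW tau0)) + /(ler_wpM2l (ltW tau0)).
rewrite !mulrA; lra.
Qed.

(** There are finitely many deterministic policies, so the positive gaps of the suboptimal ones have
    a positive lower bound. It serves to show that [value_gap] is positive. *)
Lemma value_gap_bound {R : realType} {S A : finType} (M : mdp R S A)
    (Sd : {set S}) (x : allocation R Sd) (mstar : S -> A -> R) :
  best_response M x mstar ->
  exists2 b : R, 0 < b & forall m, occ_det M m -> ~ best_response M x m ->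
    pairing (follower_reward M x) m <= pairing (follower_reward M x) mstar - b.
Proof.
move=> [Mm mmax]; set f := pairing _ in mmax *.
pose occ (d : {ffun S -> A}) := occupancy M (det_policy d).
(* The value 1 at optimal policies is an arbitrary positive default that keeps the minimum
   positive. *)
pose gap d := if pselect (best_response M x (occ d)) then 1 else f mstar - f (occ d).
have Mocc d : occ_set M (occ d) by apply/occupancy_in_occ_set/det_policy_policy.
have gap0 d : 0 < gap d.
  rewrite /gap; case: pselect => // nBR; rewrite subr_gt0 ltNge; apply/negP => fle.
  by apply: nBR; split=> // y /mmax yle; exact: le_trans yle fle.
exists (\big[Order.min/1]_d gap d).
  by apply: (big_ind (fun y => 0 < y)) => // y z y0 z0; rewrite lt_min y0.
move=> _ [pi [pol det ->]] nBR; have [d piE] := deterministic_det_policy pi pol det.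
have gapE : gap d = f mstar - f (occupancy M pi).
  by rewrite piE in nBR *; rewrite /gap; case: pselect.
by have := bigmin_le 1 d gap; rewrite gapE; lra.
Qed.

(* Minimizing [b r_1 - v r_2] over the occupancy measures, with
   [v = <r_1, mstar>]: at a deterministic minimizer the bound is either the
   equality case of [interior_leader_value] or the definition of the gap. *)
Lemma leader_loss_le {R : realType} {S A : finType} (M : mdp R S A)
    (Sd : {set S}) (x : allocation R Sd) (mstar m : S -> A -> R) (b : R) :
  (0 < #|A|)%N -> interior (alloc_region M (Sd:=Sd) mstar) x ->
  0 <= b ->
  (forall m, occ_det M m -> ~ best_response M x m ->
    pairing (follower_reward M x) m <= pairing (follower_reward M x) mstar - b) ->
  occ_set M m ->
  b * (pairing (leader_reward R Sd) mstar - pairing (leader_reward R Sd) m) <=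
  pairing (leader_reward R Sd) mstar *
    (pairing (follower_reward M x) mstar - pairing (follower_reward M x) m).
Proof.
move=> A0 xint b0 gapb Mm.
have [Mmstar mmax] : best_response M x mstar by exact: nbhs_singleton xint.
set r1 := leader_reward R Sd; set r2 := follower_reward M x in mmax gapb *.
set v := pairing r1 mstar.
have lin m' : pairing (fun s a => b * r1 s a - v * r2 s a) m' =
    b * pairing r1 m' - v * pairing r2 m'.
  rewrite /pairing !mulr_sumr -sumrB; apply: eq_bigr => s _ /=.
  rewrite !mulr_sumr -sumrB; apply: eq_bigr => a _ /=; ring.
have r1_ge0 m' : occ_set M m' -> 0 <= pairing r1 m'.
  move=> [m'0 _]; rewrite pairing_leader.
  by apply: sumr_ge0 => s _; apply: sumr_ge0 => a _.
have [m' m'det] := pairing_min_det M A0 (fun s a => b * r1 s a - v * r2 s a) m Mm.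
rewrite !lin.
have Mm' : occ_set M m'.
  by case: m'det => pi [pol _ ->]; exact: occupancy_in_occ_set.
suff : b * v - v * pairing r2 mstar <= b * pairing r1 m' - v * pairing r2 m'.
  by rewrite !mulrBr; lra.
have [BR|nBR] := pselect (best_response M x m').
  have -> : pairing r1 m' = v by exact: (interior_leader_value M Sd x).
  have -> // : pairing r2 m' = pairing r2 mstar.
  by apply/eqP; rewrite eq_le mmax //= BR.2.
(* A suboptimal [m'] loses at least [b] in [r2]; weighted by [v], this already pays for [b * v], and
   [b * pairing r1 m'] is nonnegative. *)
have := ler_wpM2l (r1_ge0 _ Mmstar) (gapb _ m'det nBR).
have := mulr_ge0 b0 (r1_ge0 _ Mm').
by rewrite -/v mulrBr; lra.
Qed.

Theorem proposition8 (R : realType) (S A : finType)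
  (S_nonempty : (0 < #|S|)%N) (A_nonempty : (0 < #|A|)%N)
  (M : mdp R S A) (Sd : {set S}) (Sd_nonempty : Sd != finset.set0)
  (C : R) (C_ge0 : 0 <= C)
  (xstar : allocation R Sd) (mstar : S -> A -> R)
  (opt : reward_design_optimal M C xstar mstar)
  (xstar_interior : interior (alloc_region M (Sd:=Sd) mstar) xstar)
  (tau : R) (tau_gt0 : 0 < tau) (mtau : S -> A -> R)
  (mtau_argmax : argmax (occ_set M) (regularized_value M xstar tau) mtau) :
  (((1 - (2 * tau)%:E / (value_gap M xstar mstar * (1 - discount M)%:E)
         * (ln (#|A|%:R : R))%:E)
    * (pairing (leader_reward R Sd) mstar)%:E
    <= (pairing (leader_reward R Sd) mtau)%:E)%E).
Proof.
have BR : best_response M xstar mstar by exact: nbhs_singleton xstar_interior.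
have Mmtau := mtau_argmax.1.
have loss := regularized_argmax_gap M Sd xstar tau mstar mtau A_nonempty tau_gt0
  BR.1 mtau_argmax.
have [b0 b0_gt0 gap0] := value_gap_bound M Sd xstar mstar BR.
have c0 : 0 < 1 - discount M by rewrite subr_gt0 discount_lt1.
have v_ge0 : 0 <= pairing (leader_reward R Sd) mstar.
  rewrite pairing_leader; apply: sumr_ge0 => s _.
  by apply: sumr_ge0 => a _; exact: BR.1.1.
rewrite /value_gap; set E := [set _ | _ in _].
have supE m : occ_det M m -> ~ best_response M xstar m ->
    ((pairing (follower_reward M xstar) m)%:E <= ereal_sup E)%E.
  by move=> mdet nBR; apply: ereal_sup_ubound; exists m => //; split=> // -[].
have : (ereal_sup E <=
    (pairing (follower_reward M xstar) mstar - b0)%:E)%E.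
  apply: ge_ereal_sup => _ [m [mdet nopt] <-]; rewrite lee_fin; apply: gap0 => //.
  by move=> mBR; apply: nopt.
set V := pairing (follower_reward M xstar) mstar in loss gap0 *.
(* The bound by a real number excludes [+oo]; a finite supremum [r] gives the gap [V - r], and [-oo]
   an infinite gap. *)
case: (ereal_sup E) supE => [r||] supE //=.
  rewrite lee_fin => rb0.
  have b_gt0 : 0 < V - r by lra.
  have := leader_loss_le M Sd xstar mstar mtau (V - r) A_nonempty xstar_interior
    (ltW b_gt0) _ Mmtau.
  move=> /(_ _)/wrap[m mdet nBR|].
    by rewrite opprB addrCA subrr addr0 -lee_fin; exact: supE.
  rewrite -!EFinM inver mulf_eq0 !gt_eqF //= -!EFinM lee_fin.
  set v := pairing _ mstar; set p := pairing _ mtau => le1.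
  have le2 := le_trans le1 (ler_wpM2l v_ge0 loss).
  rewrite -/v mulrBr in le2.
  rewrite -(ler_pM2l b_gt0).
  have -> : (V - r) * ((1 - 2 * tau / ((V - r) * (1 - discount M)) * ln #|A|%:R) * v) =
    (V - r) * v - 2 * (v * (tau * ln #|A|%:R / (1 - discount M))).
    by field; rewrite !gt_eqF.
  (* This nonnegative term is the slack between the bound obtained and the one with the factor 2. *)
  have : 0 <= v * (tau * ln (#|A|%:R : R) / (1 - discount M)).
    rewrite mulr_ge0 // divr_ge0 ?(ltW c0) // mulr_ge0 ?(ltW tau_gt0) //.
    by rewrite ln_ge0 // ler1n.
  lra.
(* With an infinite gap the coefficient is 1. A deterministic minimizer of [r_1] must be a best
   response, since otherwise the supremum would not be [-oo]; interiority then gives it the leader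
   value of [mstar]. *)
move=> _; rewrite /= addey // gt0_mulye ?lte_fin // invey mule0 mul0e sube0 mul1e.
rewrite lee_fin.
have [m' m'det le'] := pairing_min_det M A_nonempty (leader_reward R Sd) mtau Mmtau.
rewrite -(interior_leader_value M Sd xstar mstar m') //.
by apply: contrapT => /(supE _ m'det); rewrite leeNy_eq.
Qed.
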